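(* Let $d\ge 1$ and let $k_g$ be a real-valued symmetric positive semidefinite kernel on $\mathbb{R}\times\mathbb{R}^d$ of class $C^2$ (for instance the radial basis function kernel $k_g(\mathbf{x}_1,\mathbf{x}_2)=\exp(-\|\mathbf{x}_1-\mathbf{x}_2\|_2^2/\ell^2)$ with $\ell>0$). Write points as $\mathbf{x}=(\xi,\mathcal{X})$ with $\xi\in\mathbb{R}$, $\mathcal{X}\in\mathbb{R}^d$, put $s(\xi)=\xi^2(1-\xi)^2$, and define $$k(\mathbf{x}_1,\mathbf{x}_2)=s(\xi_1)\,k_g(\mathbf{x}_1,\mathbf{x}_2)\,s(\xi_2).$$ Then the zero-mean Gaussian process regressor with kernel $k$ generates functions $\tilde r(\xi,\mathcal{X})$ satisfying the boundary conditions $$\tilde r(0,\mathcal{X})=\tilde r(1,\mathcal{X})=\frac{\partial\tilde r}{\partial\xi}(0,\mathcal{X})=\frac{\partial\tilde r}{\partial\xi}(1,\mathcal{X})=0 .$$ That is, for every $N\geq 1$, all training inputs $\mathbf{X}=(\mathbf{x}^{(1)},\dots,\mathbf{x}^{(N)})$ with $\mathbf{x}^{(i)}\in[0,1]\times\mathbb{R}^d$, all training outputs $\mathbf{y}\in\mathbb{R}^N$, every noise variance $\sigma_n^2>0$ and every $\mathcal{X}\in\mathbb{R}^d$, with test points $\hat{\mathbf{x}}=\big((0,\mathcal{X}),(1,\mathcal{X})\big)$, a sample $\mathbf{y}_s\in\mathbb{R}^2$ of the posterior values at $\hat{\mathbf{x}}$, which has distribution $\mathcal{N}(\boldsymbol\mu,\boldsymbol\Sigma)$,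 and a sample $\mathbf{y}_s'\in\mathbb{R}^2$ of the posterior $\xi$-derivatives at $\hat{\mathbf{x}}$, which has distribution $\mathcal{N}(\boldsymbol\mu',\boldsymbol\Sigma')$, satisfy $\mathbf{y}_s=\mathbf{0}$ and $\mathbf{y}_s'=\mathbf{0}$ almost surely.
   Context: Here $\xi$ is normalized time and $\mathcal{X}$ collects the remaining problem parameters. For a vector-valued residual, each scalar component is modeled in this way, so a scalar output is considered. For lists of points $A=(\mathbf{a}_i)$, $B=(\mathbf{b}_j)$, let $\mathbf{K}(A,B)$ be the matrix with entries $k(\mathbf{a}_i,\mathbf{b}_j)$. Let $\mathbf{K}_{10}(A,B)$, $\mathbf{K}_{01}(A,B)$, $\mathbf{K}_{11}(A,B)$ be the matrices with entries $k_{10}(\mathbf{a}_i,\mathbf{b}_j)$, $k_{01}(\mathbf{a}_i,\mathbf{b}_j)$, $k_{11}(\mathbf{a}_i,\mathbf{b}_j)$, where $$k_{10}=\frac{\partial k(\mathbf{x}_1,\mathbf{x}_2)}{\partial\xi_1},\quad k_{01}=\frac{\partial k(\mathbf{x}_1,\mathbf{x}_2)}{\partial\xi_2},\quad k_{11}=\frac{\partial^2 k(\mathbf{x}_1,\mathbf{x}_2)}{\partial\xi_1\,\partial\xi_2}.$$ Let $\mathbf{M}=\mathbf{K}(\mathbf{X},\mathbf{X})+\sigma_n^2\,\mathbb{1}$, with $\mathbb{1}$ the $N\times N$ identity matrix. The Gaussian process posterior at test points $\hat{\mathbf{x}}$ is given by $$\boldsymbol\mu=\mathbf{K}(\hat{\mathbf{x}},\mathbf{X})\mathbf{M}^{-1}\mathbf{y},\qquad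 \boldsymbol\Sigma=\mathbf{K}(\hat{\mathbf{x}},\hat{\mathbf{x}})-\mathbf{K}(\hat{\mathbf{x}},\mathbf{X})\mathbf{M}^{-1}\mathbf{K}(\mathbf{X},\hat{\mathbf{x}}),$$ and the posterior of the $\xi$-derivative by $$\boldsymbol\mu'=\mathbf{K}_{10}(\hat{\mathbf{x}},\mathbf{X})\mathbf{M}^{-1}\mathbf{y},\qquad \boldsymbol\Sigma'=\mathbf{K}_{11}(\hat{\mathbf{x}},\hat{\mathbf{x}})-\mathbf{K}_{10}(\hat{\mathbf{x}},\mathbf{X})\mathbf{M}^{-1}\mathbf{K}_{01}(\mathbf{X},\hat{\mathbf{x}}).$$ Gaussian distributions may be degenerate: $\mathcal{N}(\mathbf{m},\mathbf{0})$ is the point mass at $\mathbf{m}$. *)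

(* Defs.v *)
From HB Require Import structures.
From mathcomp Require Import all_boot all_order all_algebra.
From mathcomp Require Import all_classical all_reals all_analysis.

Set Implicit Arguments.
Unset Strict Implicit.
Unset Printing Implicit Defensive.

Import Order.TTheory GRing.Theory Num.Theory.
Import numFieldNormedType.Exports.

Local Open Scope classical_set_scope.
Local Open Scope ring_scope.

(* f is of class C^k.  When V is finite dimensional, as here, continuity of
   x |-> 'd f x v for each direction v is continuity of all partial derivatives,
   equivalently of x |-> 'd f x in operator norm. *)
Fixpoint class_C (R : realType) (V : normedModType R) (k : nat) (f : V -> R)
    {struct k} : Prop :=
  match k with
  | 0%N => continuous f
  | k'.+1 => (forall x, differentiable f x) /\
             (forall v, class_C k' (fun x => 'd f x v))
  end.

Definition symmetric_kernel (R : realType) (T : Type) (k : T -> T -> R) : Prop :=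
  forall x1 x2, k x1 x2 = k x2 x1.

Definition psd_kernel (R : realType) (T : Type) (k : T -> T -> R) : Prop :=
  forall (n : nat) (x : 'I_n -> T) (c : 'I_n -> R),
    0 <= \sum_(i < n) \sum_(j < n) c i * c j * k (x i) (x j).

(* Points (xi, X) of R x R^d; the norm is the sup norm, which induces the usual
   topology and differentiability. *)
Notation input R d := (R * 'rV[R]_d)%type.

Definition kernel_C (R : realType) (d n : nat)
    (k : input R d -> input R d -> R) : Prop :=
  class_C n (fun p : input R d * input R d => k p.1 p.2).

Definition boundary_weight (R : realType) (xi : R) : R :=
  xi ^+ 2 * (1 - xi) ^+ 2.

Definition boundary_kernel (R : realType) (d : nat)
    (kg : input R d -> input R d -> R) (x1 x2 : input R d) : R :=
  boundary_weight x1.1 * kg x1 x2 * boundary_weight x2.1.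

Definition kernel10 (R : realType) (d : nat) (k : input R d -> input R d -> R)
    (x1 x2 : input R d) : R :=
  derive1 (fun xi1 : R => k (xi1, x1.2) x2) x1.1.

Definition kernel01 (R : realType) (d : nat) (k : input R d -> input R d -> R)
    (x1 x2 : input R d) : R :=
  derive1 (fun xi2 : R => k x1 (xi2, x2.2)) x2.1.

Definition kernel11 (R : realType) (d : nat) (k : input R d -> input R d -> R)
    : input R d -> input R d -> R :=
  kernel10 (kernel01 k).

Definition kernel_mx (R : realType) (T : Type) (k : T -> T -> R) (m n : nat)
    (A : 'I_m -> T) (B : 'I_n -> T) : 'M[R]_(m, n) :=
  \matrix_(i, j) k (A i) (B j).

Section Posterior.
Context (R : realType) (d : nat) (k : input R d -> input R d -> R).
Context (N n : nat) (X : 'I_N -> input R d) (y : 'cV[R]_N) (sigma_n : R).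
Context (xhat : 'I_n -> input R d).

Definition noisy_gram : 'M[R]_N := kernel_mx k X X + (sigma_n ^+ 2)%:M.

Definition post_mean : 'cV[R]_n :=
  kernel_mx k xhat X *m invmx noisy_gram *m y.

Definition post_cov : 'M[R]_n :=
  kernel_mx k xhat xhat
  - kernel_mx k xhat X *m invmx noisy_gram *m kernel_mx k X xhat.

Definition post_dmean : 'cV[R]_n :=
  kernel_mx (kernel10 k) xhat X *m invmx noisy_gram *m y.

Definition post_dcov : 'M[R]_n :=
  kernel_mx (kernel11 k) xhat xhat
  - kernel_mx (kernel10 k) xhat X *m invmx noisy_gram
      *m kernel_mx (kernel01 k) X xhat.

End Posterior.

Definition boundary_points (R : realType) (d : nat) (X : 'rV[R]_d)
    : 'I_2 -> input R d :=
  tnth [tuple (0, X); (1, X)].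

(* The one-dimensional normal law of mean m and variance v >= 0;
   normal_prob takes the standard deviation, and normal_prob m 0 is not the
   point mass at m. *)
Definition normal_law (R : realType) (m v : R) : set R -> \bar R :=
  if v == 0 then dirac m else normal_prob m (Num.sqrt v).

(* Y ~ N(m, S), possibly degenerate: S is symmetric positive semidefinite and
   every linear combination a^T Y is normal with mean a^T m and variance
   a^T S a. For S = 0 this says that every a^T Y has law the point mass at
   a^T m. *)
Definition gaussian_vector (R : realType) (disp : measure_display)
    (Omega : measurableType disp) (P : probability Omega R) (n : nat)
    (Y : 'I_n -> {RV P >-> R}) (m : 'cV[R]_n) (S : 'M[R]_n) : Prop :=
  S^T = S /\
  forall a : 'cV[R]_n,
    let mean := (a^T *m m) 0 0 in
    let var := (a^T *m S *m a) 0 0 in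
    0 <= var /\
    forall A : set R, measurable A ->
      pushforward P (fun w => \sum_(i < n) a i 0 * Y i w) A
      = normal_law mean var A.

(* Main.v *)
(** The weight [s] has double zeros at 0 and 1, so [s f] vanishes there together
    with its first derivative for every differentiable [f].  Hence the kernel, its
    first derivatives and its mixed derivative vanish as soon as an argument lies
    on the boundary, both posterior laws have zero mean and zero covariance, and
    each component of a sample has law [dirac 0]. *)

Require Import Defs.
From HB Require Import structures.
From mathcomp Require Import all_boot all_order all_algebra.
From mathcomp Require Import all_classical all_reals all_analysis.

Set Implicit Arguments.
Unset Strict Implicit.
Unset Printing Implicit Defensive.

Import Order.TTheory GRing.Theory Num.Theory.
Import numFieldNormedType.Exports.

Local Open Scope classical_set_scope.
Local Open Scope ring_scope.

Lemma boundary_weight_eq0 (R : realType) (xi : R) :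
  (boundary_weight xi == 0) = (xi == 0) || (xi == 1).
Proof.
rewrite /boundary_weight mulf_eq0 !expf_eq0 /= subr_eq0.
by rewrite (eq_sym 1).
Qed.

(** The weight is the square of [xi * (1 - xi)], so its derivative carries the factor [b * (1 - b)],
    which is zero wherever the weight is. *)
Lemma is_derive_boundary_weight (R : realType) (b : R) :
  boundary_weight b = 0 -> is_derive b 1 (@boundary_weight R) 0.
Proof.
move=> /eqP b0; have -> : @boundary_weight R = (id * (cst 1 - id)) ^+ 2.
  by apply/funext => x; rewrite /boundary_weight -exprMn.
apply: is_derive_eq; rewrite !fctE expr1.
suff -> : b * (1 - b) = 0 by rewrite mulr0 scale0r.
by move: b0; rewrite /boundary_weight -exprMn expf_eq0 => /eqP.
Qed.

(** In the product rule [s' f + s f'], both [s] and [s'] vanish at [b]. *)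
Lemma derive1_boundary_weightM (R : realType) (f : R -> R) (b : R) :
  boundary_weight b = 0 -> derivable f b 1 ->
  derive1 (fun xi => boundary_weight xi * f xi) b = 0.
Proof.
move=> b0 df; rewrite derive1E.
have ds := is_derive_boundary_weight b0.
have dsf := is_deriveM ds (derivableP df).
by rewrite (@derive_val _ _ _ _ _ _ _ dsf) b0 scale0r scaler0 addr0.
Qed.

Lemma kernel_mx_eq0 (R : realType) (T : Type) (h : T -> T -> R) (p q : nat)
    (A : 'I_p -> T) (B : 'I_q -> T) :
  (forall i j, h (A i) (B j) = 0) -> kernel_mx h A B = 0.
Proof. by move=> h0; apply/matrixP => i j; rewrite !mxE. Qed.

Section BoundaryKernel.
Context (R : realType) (d : nat) (kg : input R d -> input R d -> R).
Context (kg_diff : forall p : input R d * input R d,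
  differentiable (fun q : input R d * input R d => kg q.1 q.2) p).
Local Notation k := (boundary_kernel kg).

Lemma derivable_kernel_l (chi : 'rV[R]_d) (x2 : input R d) (b : R) :
  derivable (fun xi : R => kg (xi, chi) x2) b 1.
Proof.
apply/derivable1_diffP.
apply: (@differentiable_comp _ _ _ _ (fun xi : R => ((xi, chi), x2))
  (fun q : input R d * input R d => kg q.1 q.2)); last exact: kg_diff.
by do 2!apply: differentiable_pair => //.
Qed.

Lemma derivable_kernel_r (x1 : input R d) (chi : 'rV[R]_d) (b : R) :
  derivable (fun xi : R => kg x1 (xi, chi)) b 1.
Proof.
apply/derivable1_diffP.
apply: (@differentiable_comp _ _ _ _ (fun xi : R => (x1, (xi, chi)))
  (fun q : input R d * input R d => kg q.1 q.2)); last exact: kg_diff.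
by do 2!apply: differentiable_pair => //.
Qed.

Lemma boundary_kernel_eq0 (x1 x2 : input R d) :
  boundary_weight x1.1 = 0 -> k x1 x2 = 0.
Proof. by rewrite /boundary_kernel => ->; rewrite !mul0r. Qed.

Lemma kernel10_boundary_eq0 (x1 x2 : input R d) :
  boundary_weight x1.1 = 0 -> kernel10 k x1 x2 = 0.
Proof.
move=> b0; rewrite /kernel10 /boundary_kernel /=.
under eq_fun do rewrite -mulrA.
apply: derive1_boundary_weightM => //.
by apply: derivableM => //; exact: derivable_kernel_l.
Qed.

Lemma kernel01_boundary_eq0 (x1 x2 : input R d) :
  boundary_weight x2.1 = 0 -> kernel01 k x1 x2 = 0.
Proof.
move=> b0; rewrite /kernel01 /boundary_kernel /=.
(* Commuting puts the weight of the varying second argument in front; the other weight is a constant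
   factor. *)
under eq_fun do rewrite mulrC.
apply: (@derive1_boundary_weightM _
  (fun xi => boundary_weight x1.1 * kg x1 (xi, x2.2)) _ b0).
apply: (@derivableM _ _ (cst _)); first exact: derivable_cst.
exact: derivable_kernel_r.
Qed.

(** With [x2] fixed on the boundary, [kernel01 k] is zero for every first argument, so the outer
    derivative is that of the zero function. *)
Lemma kernel11_boundary_eq0 (x1 x2 : input R d) :
  boundary_weight x2.1 = 0 -> kernel11 k x1 x2 = 0.
Proof.
move=> b0; rewrite /kernel11 /kernel10.
under eq_fun do rewrite kernel01_boundary_eq0//.
exact: derive1_cst.
Qed.

Section BoundaryPosterior.
Context (N n : nat) (X : 'I_N -> input R d) (y : 'cV[R]_N) (sigma_n : R).
Context (xhat : 'I_n -> input R d).
Context (xhat0 : forall i, boundary_weight (xhat i).1 = 0).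

Lemma post_mean_boundary_eq0 : post_mean k X y sigma_n xhat = 0.
Proof.
rewrite /post_mean kernel_mx_eq0 ?mul0mx// => i j.
exact: boundary_kernel_eq0.
Qed.

Lemma post_cov_boundary_eq0 : post_cov k X sigma_n xhat = 0.
Proof.
by rewrite /post_cov !(kernel_mx_eq0 (A := xhat)) ?mul0mx ?subr0// => i j;
  exact: boundary_kernel_eq0.
Qed.

Lemma post_dmean_boundary_eq0 : post_dmean k X y sigma_n xhat = 0.
Proof.
rewrite /post_dmean kernel_mx_eq0 ?mul0mx// => i j.
exact: kernel10_boundary_eq0.
Qed.

Lemma post_dcov_boundary_eq0 : post_dcov k X sigma_n xhat = 0.
Proof.
(* The prior term vanishes through its second argument; the correction term vanishes through the
   first argument of its left factor. *)
rewrite /post_dcov (kernel_mx_eq0 (h := kernel11 k)); last first.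
  by move=> i j; exact: kernel11_boundary_eq0.
rewrite (kernel_mx_eq0 (h := kernel10 k)) ?mul0mx ?subr0// => i j.
exact: kernel10_boundary_eq0.
Qed.

End BoundaryPosterior.
End BoundaryKernel.

Lemma boundary_weight_boundary_points (R : realType) (d : nat)
    (chi : 'rV[R]_d) (i : 'I_2) :
  boundary_weight (boundary_points chi i).1 = 0.
Proof.
apply/eqP; rewrite boundary_weight_eq0.
by case: i => [[|[|//]] ?]; rewrite /boundary_points (tnth_nth (0, chi)) /=
  eqxx ?orbT.
Qed.

(** Each coordinate has law [dirac 0], which gives the complement of [0] no mass; finitely many
    almost sure events then hold jointly. *)
Lemma gaussian_vector0_ae_eq0 (R : realType) (disp : measure_display)
    (Omega : measurableType disp) (P : probability Omega R) (n : nat)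
    (Y : 'I_n -> {RV P >-> R}) :
  gaussian_vector Y 0 0 -> \forall w \ae P, forall i, Y i w = 0.
Proof.
move=> [_ Y0]; apply: filter_forall => i.
have mA : measurable (~` [set (0 : R)]) by exact: measurableC.
(* The basis vector as direction extracts the law of [Y i]; its variance is zero, so [normal_law]
   takes its [dirac] branch. *)
have [_ /(_ _ mA)] := Y0 (delta_mx i 0).
rewrite /normal_law !(mulmx0, mul0mx) mxE eqxx diracE memNset; last by apply.
under eq_fun => w.
  rewrite (bigD1 i) //= big1 => [|j ji].
    by rewrite mxE !eqxx mul1r addr0; over.
  by rewrite mxE (negPf ji) mul0r.
(* The exceptional set is the preimage of the complement of [0] under [Y i]; its measurability is
   the remaining goal. *)
move=> PY0; apply/negligibleP; last exact: PY0.
by rewrite -[X in measurable X]setTI; exact: (measurable_funPT (Y i) measurableT _ mA).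
Qed.

Theorem theoremV1 (R : realType) (d : nat) (hd : (1 <= d)%N)
    (kg : input R d -> input R d -> R)
    (kg_sym : symmetric_kernel kg) (kg_psd : psd_kernel kg)
    (kg_C2 : kernel_C 2 kg)
    (N : nat) (hN : (1 <= N)%N)
    (X : 'I_N -> input R d) (hX : forall i, 0 <= (X i).1 <= 1)
    (y : 'cV[R]_N) (sigma_n : R) (hsigma : 0 < sigma_n ^+ 2)
    (chi : 'rV[R]_d)
    (disp : measure_display) (Omega : measurableType disp)
    (P : probability Omega R) (Ys Ys' : 'I_2 -> {RV P >-> R}) :
  let k := boundary_kernel kg in
  let xhat := boundary_points chi in
  (gaussian_vector Ys (post_mean k X y sigma_n xhat)
                      (post_cov k X sigma_n xhat) ->
   \forall w \ae P, forall i, Ys i w = 0) /\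
  (gaussian_vector Ys' (post_dmean k X y sigma_n xhat)
                       (post_dcov k X sigma_n xhat) ->
   \forall w \ae P, forall i, Ys' i w = 0).
Proof.
(* The first component of the class $C^2$ condition is joint differentiability of [kg]. *)
move=> k xhat; have kg_diff := kg_C2.1.
have xhat0 := boundary_weight_boundary_points chi.
split.
- rewrite post_mean_boundary_eq0// post_cov_boundary_eq0//.
  exact: gaussian_vector0_ae_eq0.
- rewrite post_dmean_boundary_eq0// post_dcov_boundary_eq0//.
  exact: gaussian_vector0_ae_eq0.
Qed.
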